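(* Let $L\subset\mathbb{R}^n$ be an $n$-dimensional lattice and let $B=[b_1|\dots|b_n]^t$ be a basis of $L$. Then $$\mathrm{od}(B)\le 1-\frac{1}{e}\left(\frac{n}{S(B)+1}\right)^{n-1},$$ where $\mathrm{od}(B)$ is the orthogonality defect of $B$ and $S(B)$ is the Seysen measure of $B$.
   Context: An $n$-dimensional lattice $L\subset\mathbb{R}^n$ is a set $L=\{\sum_{i=1}^n a_i b_i : a_i\in\mathbb{Z}\}$ with $b_1,\dots,b_n\in\mathbb{R}^n$ linearly independent over $\mathbb{R}$. A basis of $L$ is identified with the matrix $B=[b_1|\dots|b_n]^t$ whose rows $b_i$ are linearly independent and generate $L$ over $\mathbb{Z}$. The dual basis is $B^*=(B^{-1})^t=[b_1^*|\dots|b_n^*]^t$, so that $\langle b_i,b_j^*\rangle=\delta_{i,j}$. The Seysen measure of $B$ is $S(B)=\sum_{i=1}^n\|b_i\|^2\,\|b_i^*\|^2$, where $\|\cdot\|$ is the Euclidean norm on vectors. The orthogonality defect of $B$ is $\mathrm{od}(B)=1-\dfrac{\det BB^t}{\prod_{i=1}^n\|b_i\|^2}\in[0,1]$. *)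

(* Defs.v *)
From HB Require Import structures.
From mathcomp Require Import all_boot all_order all_algebra.
From mathcomp Require Import classical_sets reals.

Set Implicit Arguments.
Unset Strict Implicit.
Unset Printing Implicit Defensive.

Import Order.TTheory GRing.Theory Num.Theory.
Local Open Scope classical_set_scope.
Local Open Scope ring_scope.

(* The norm that MathComp-Analysis puts on matrices is the sup norm, hence
   an explicit Euclidean norm. *)
Definition enorm (R : realType) (n : nat) (v : 'rV[R]_n) : R :=
  Num.sqrt (\sum_(j < n) v 0 j ^+ 2).

Definition zspan (R : realType) (m n : nat) (B : 'M[R]_(m, n)) :
    set 'rV[R]_n :=
  [set v | exists a : 'I_m -> int, v = \sum_(i < m) (a i)%:~R *: row i B].

(* Basis vectors are the rows of B. *)
Definition is_basis (R : realType) (n : nat) (L : set 'rV[R]_n)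
    (B : 'M[R]_n) : Prop :=
  row_free B /\ L = zspan B.

Definition is_lattice (R : realType) (n : nat) (L : set 'rV[R]_n) : Prop :=
  exists B : 'M[R]_n, is_basis L B.

Definition dual_basis (R : realType) (n : nat) (B : 'M[R]_n) : 'M[R]_n :=
  (invmx B)^T.

Definition seysen (R : realType) (n : nat) (B : 'M[R]_n) : R :=
  \sum_(i < n) enorm (row i B) ^+ 2 * enorm (row i (dual_basis B)) ^+ 2.

Definition orth_defect (R : realType) (n : nat) (B : 'M[R]_n) : R :=
  1 - \det (B *m B^T) / \prod_(i < n) enorm (row i B) ^+ 2.

(* Main.v *)
Require Import Defs.
From mathcomp Require Import all_boot all_order all_algebra.
From mathcomp Require Import classical_sets reals sequences exp.

Import Order.TTheory GRing.Theory Num.Theory.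
Local Open Scope ring_scope.

(** Let [H] be the Gram matrix of the dual basis, i.e. the inverse of
    [B *m B^T].  Cramer's rule writes [|b_i|^2] as the [i]-th principal minor of
    [H] divided by [\det H], and Hadamard's inequality bounds that minor by
    [\prod_(j != i) |b*_j|^2].  Multiplying over [i], with [d = \det (B *m B^T)],
    [P = \prod_i |b_i|^2] and [Q = \prod_i |b*_i|^2], gives
    [P <= d^n Q^(n-1)]; AM-GM gives [P Q <= (S/n)^n].  Hence
    [d / P >= (n / S)^(n-1)], which is stronger than what is claimed. *)

Definition posdefmx {R : realFieldType} {n} (A : 'M[R]_n) : Prop :=
  A^T = A /\ forall x : 'rV_n, x != 0 -> 0 < (x *m A *m x^T) 0 0.

Section PositiveDefinite.
Set Implicit Arguments.
Unset Strict Implicit.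
Variable R : realFieldType.

Lemma mulmx_tr_diag m n (A : 'M[R]_(m, n)) i :
  (A *m A^T) i i = \sum_j A i j ^+ 2.
Proof. by rewrite mxE; apply: eq_bigr => j _; rewrite mxE expr2. Qed.

(** The form at [x] is the squared Euclidean norm of [x *m A], which vanishes only for [x = 0] when
    the rows are free. *)
Lemma gram_posdefmx m n (A : 'M[R]_(m, n)) :
  row_free A -> posdefmx (A *m A^T).
Proof.
move=> fA; split=> [|x x0]; first by rewrite trmx_mul trmxK.
rewrite mulmxA -mulmxA -trmx_mul mulmx_tr_diag.
rewrite lt0r sumr_ge0 ?andbT => [|j _]; last exact: sqr_ge0.
apply: contraNneq x0 => /eqP; rewrite psumr_eq0 => [/allP y0|j _]; last first.
  exact: sqr_ge0.
apply/eqP/(row_free_inj fA); rewrite mul0mx; apply/rowP => j.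
by have := y0 j (mem_index_enum _); rewrite sqrf_eq0 => /eqP ->; rewrite mxE.
Qed.

Lemma mxsub_posdefmx m n (f : 'I_m -> 'I_n) (A : 'M[R]_n) :
  injective f -> posdefmx A -> posdefmx (mxsub f f A).
Proof.
move=> f_inj [At Apos]; split=> [|x x0]; first by rewrite trmx_mxsub At.
(* The submatrix is [P *m A *m P^T] for the selection matrix [P]. Injectivity of [f] gives
   [P *m P^T = 1], so [x *m P] is nonzero with [x]. *)
pose P : 'M[R]_(m, n) := rowsub f 1%:M.
have PP : P *m P^T = 1%:M.
  rewrite trmx_mxsub trmx1 mul_rowsub_mx mul1mx.
  by apply/matrixP => i j; rewrite !mxE (inj_eq f_inj).
have -> : mxsub f f A = P *m A *m P^T.
  rewrite trmx_mxsub trmx1 mul_rowsub_mx mul1mx mulmx_colsub mulmx1.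
  by apply/matrixP => i j; rewrite !mxE.
rewrite !mulmxA -mulmxA -trmx_mul; apply: Apos.
by apply: contraNneq x0 => xP0; rewrite -[x]mulmx1 -PP mulmxA xP0 mul0mx.
Qed.

Lemma posdefmx_diag_gt0 n (A : 'M[R]_n) i : posdefmx A -> 0 < A i i.
Proof.
move=> [_ /(_ (delta_mx 0 i))]; rewrite -rowE trmx_delta -colE !mxE; apply.
by apply/eqP => /matrixP/(_ 0 i); rewrite !mxE !eqxx => /eqP; rewrite oner_eq0.
Qed.

Definition schur_compl n (A : 'M[R]_(1 + n)) : 'M[R]_n :=
  drsubmx A - (A 0 0)^-1 *: (dlsubmx A *m ursubmx A).

Lemma det_schur_compl n (A : 'M[R]_(1 + n)) :
  A 0 0 != 0 -> \det A = A 0 0 * \det (schur_compl A).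
Proof.
move=> a0; set a := A 0 0.
(* One round of Gaussian elimination: [L] has determinant 1 and clears the first column below the
   pivot [a]. *)
pose L := block_mx 1%:M 0 (- a^-1 *: dlsubmx A) (1%:M : 'M_n).
have aE : ulsubmx A = a%:M.
  by rewrite [LHS]mx11_scalar !mxE !lshift0.
have <- : \det (L *m A) = \det A.
  by rewrite det_mulmx det_lblock !det1 mulr1 mul1r.
rewrite -[A in L *m A]submxK mulmx_block !mul1mx !mul0mx !addr0 aE.
rewrite mul_mx_scalar scalerA mulrN mulfV // scaleN1r addNr.
by rewrite det_ublock det_scalar1 -scalemxAl addrC scaleNr.
Qed.

Lemma posdefmx_schur_compl n (A : 'M[R]_(1 + n)) :
  posdefmx A -> posdefmx (schur_compl A).
Proof.
move=> Apd; have [At Apos] := Apd.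
have a_gt0 : 0 < A 0 0 by exact: posdefmx_diag_gt0.
have ulE : ulsubmx A = (A 0 0)%:M.
  by rewrite [LHS]mx11_scalar !mxE !lshift0.
have drt : (drsubmx A)^T = drsubmx A by rewrite trmx_drsub At.
have urt : (ursubmx A)^T = dlsubmx A by rewrite trmx_ursub At.
have dlt : (dlsubmx A)^T = ursubmx A by rewrite trmx_dlsub At.
split=> [|y y0].
  by rewrite /schur_compl linearB linearZ /= trmx_mul drt urt dlt.
(* The first coordinate is chosen so that [x *m A] is 0 followed by [y *m schur_compl A]; the form
   of [A] at [x] is then that of the Schur complement at [y]. *)
pose x := row_mx (- (A 0 0)^-1 *: (y *m dlsubmx A)) y.
have x0 : x != 0.
  apply: contraNneq y0 => x0.
  by rewrite -[y](row_mxKr (- (A 0 0)^-1 *: (y *m dlsubmx A))) -/x x0 linear0.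
have := Apos x x0.
rewrite -[A in x *m A]submxK /x mul_row_block tr_row_mx mul_row_col ulE.
rewrite mul_mx_scalar scalerA mulrN mulfV ?gt_eqF // scaleN1r addNr mul0mx add0r.
by rewrite /schur_compl mulmxBr -scalemxAr -scalemxAl scaleNr addrC mulmxA.
Qed.

(** Induction on the size through the Schur complement: its diagonal entries are those of [A] minus
    the nonnegative terms [(A 0 0)^-1 * A 0 i ^+ 2]. *)
Lemma hadamard_posdefmx n (A : 'M[R]_n) :
  posdefmx A -> 0 < \det A <= \prod_i A i i.
Proof.
elim: n => [|n IHn] in A *; first by rewrite det_mx00 big_ord0 ltr01 lexx.
rewrite -[n.+1]/(1 + n)%N in A * => Apd.
have a_gt0 : 0 < A 0 0 by exact: posdefmx_diag_gt0.
have Spd := posdefmx_schur_compl Apd; have [At _] := Apd.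
have /andP[S_gt0 S_le] := IHn _ Spd.
rewrite det_schur_compl ?gt_eqF // mulr_gt0 //= big_ord_recl.
rewrite ler_pM2l //; apply: (le_trans S_le); apply: ler_prod => i _.
rewrite ltW ?posdefmx_diag_gt0 //= /schur_compl !mxE big_ord1 !mxE.
have Ai0 : A (lift 0 i) 0 = A 0 (lift 0 i) by rewrite -{1}At mxE.
rewrite !lshift0 !rshift1 Ai0 -expr2 lerBlDr lerDl.
by rewrite mulr_ge0 ?sqr_ge0 // invr_ge0 ltW.
Qed.

Lemma posdefmx_unit n (A : 'M[R]_n) : posdefmx A -> A \in unitmx.
Proof.
by move=> /hadamard_posdefmx/andP[d_gt0 _]; rewrite unitmxE unitfE gt_eqF.
Qed.

Lemma posdefmx_invmx_diag_le n (A : 'M[R]_n) i :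
  posdefmx A -> invmx A i i <= (\det A)^-1 * \prod_(j | j != i) A j j.
Proof.
case: n A i => [|n] A i Apd; first by case: i.
have /andP[d_gt0 _] := hadamard_posdefmx Apd.
rewrite /invmx posdefmx_unit // !mxE ler_pM2l ?invr_gt0 //.
(* A diagonal cofactor has sign [(-1)^(i + i) = 1], so it is a principal minor. *)
rewrite /cofactor addnn -signr_odd odd_double mul1r.
have /mxsub_posdefmx/(_ Apd)/hadamard_posdefmx/andP[_] := @lift_inj _ i.
have -> : row' i (col' i A) = mxsub (lift i) (lift i) A.
  by apply/matrixP => j k; rewrite !mxE.
move=> /le_trans; apply; rewrite le_eqVlt; apply/orP; left; apply/eqP.
rewrite [RHS]big_mkcond (bigD1_ord i) //= eqxx mul1r.
by apply: eq_bigr => j _; rewrite mxE eq_sym neq_lift.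
Qed.

(** By symmetry the inverse is congruent to [A]: its form at [x] is the form of [A] at
    [x *m invmx A]. *)
Lemma posdefmx_invmx n (A : 'M[R]_n) : posdefmx A -> posdefmx (invmx A).
Proof.
move=> Apd; have [At Apos] := Apd; have uA := posdefmx_unit Apd.
have iAt : (invmx A)^T = invmx A by rewrite trmx_inv At.
split=> // x x0.
rewrite -[invmx A](mulmxK uA) -{2}iAt !mulmxA -mulmxA -trmx_mul; apply: Apos.
by apply: contraNneq x0 => y0; rewrite -[x](mulmxKV uA) y0 mul0mx.
Qed.

Lemma prod_invmx_diag_le n (A : 'M[R]_n) :
  posdefmx A ->
  \prod_i invmx A i i <= (\det A)^-1 ^+ n * (\prod_i A i i) ^+ n.-1.
Proof.
move=> Apd; have -> : (\det A)^-1 ^+ n * (\prod_i A i i) ^+ n.-1 =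
    \prod_i ((\det A)^-1 * \prod_(j | j != i) A j j).
  rewrite big_split /= prodr_const card_ord; congr (_ * _).
  (* In the double product each [A j j] occurs once for every [i != j], that is [n.-1] times. *)
  rewrite (exchange_big_dep xpredT) //= -prodrXl; apply: eq_bigr => j _.
  rewrite (eq_bigl (predC1 j)) => [|i]; last by rewrite /= eq_sym.
  by rewrite prodr_const cardC1 card_ord.
apply: ler_prod => i _.
rewrite posdefmx_invmx_diag_le // ltW // posdefmx_diag_gt0 //.
exact: posdefmx_invmx.
Qed.

Lemma det_div_prod_diag_ge n (A : 'M[R]_n) :
  (0 < n)%N -> posdefmx A ->
  0 < \sum_i A i i * invmx A i i /\
  (n%:R / \sum_i A i i * invmx A i i) ^+ n.-1 <= \det A / \prod_i A i i.
Proof.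
move=> n_gt0 Apd; have iApd := posdefmx_invmx Apd.
have A_gt0 i : 0 < A i i by exact: posdefmx_diag_gt0.
have iA_gt0 i : 0 < invmx A i i by exact: posdefmx_diag_gt0.
have /andP[d_gt0 _] := hadamard_posdefmx Apd.
(* Applied to the inverse matrix, the bound becomes [P <= \det A ^+ n * Q ^+ n.-1]. *)
have := prod_invmx_diag_le iApd; rewrite det_inv invmxK invrK.
set S := \sum_i _; set P := \prod_i A i i; set Q := \prod_i _ => leP.
have P_gt0 : 0 < P by apply: prodr_gt0.
have Q_gt0 : 0 < Q by apply: prodr_gt0.
have S_gt0 : 0 < S.
  rewrite /S (bigD1 (Ordinal n_gt0)) //= ltr_wpDr ?mulr_gt0 //.
  by apply: sumr_ge0 => i _; rewrite mulr_ge0 // ltW.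
have nR_gt0 : 0 < n%:R :> R by rewrite ltr0n.
have AGM : P * Q <= (S / n%:R) ^+ n.
  rewrite -big_split /=.
  have [] := @leif_AGM R 'I_n predT (fun i => A i i * invmx A i i).
    by move=> i _; rewrite mulr_ge0 // ltW.
  by rewrite card_ord.
have PQ_gt0 : 0 < P * Q by rewrite mulr_gt0.
have r_gt0 : 0 < n%:R / S by rewrite divr_gt0.
(* Comparing [n]-th powers avoids roots: AM-GM bounds the left side by [(P * Q)^-1 ^+ n.-1], and
   [leP] bounds this by [(\det A / P) ^+ n]. *)
split=> //; rewrite -(ler_pXn2r n_gt0) ?nnegrE ?exprn_ge0 ?(ltW r_gt0) //;
  last by rewrite divr_ge0 ?ltW.
rewrite -exprM mulnC exprM; apply: (@le_trans _ _ ((P * Q)^-1 ^+ n.-1)).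
  apply: lerXn2r; rewrite ?nnegrE ?exprn_ge0 ?invr_ge0 ?(ltW r_gt0) //.
    exact: ltW.
  by rewrite -[n%:R / S]invf_div exprVn lef_pV2 // posrE exprn_gt0 ?divr_gt0.
rewrite expr_div_n ler_pdivlMr ?exprn_gt0 // exprVn exprMn.
rewrite -[in P ^+ n](prednK n_gt0) exprS invfM mulrC -mulrA.
rewrite [X in P * X]mulrA mulfV ?mul1r ?expf_neq0 ?gt_eqF //.
by rewrite ler_pdivrMr ?exprn_gt0.
Qed.

End PositiveDefinite.

Lemma enorm_row_sqr (R : realType) n (B : 'M[R]_n) i :
  enorm (row i B) ^+ 2 = (B *m B^T) i i.
Proof.
rewrite mulmx_tr_diag sqr_sqrtr; last by apply: sumr_ge0 => j _; exact: sqr_ge0.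
by apply: eq_bigr => j _; rewrite mxE.
Qed.

Theorem corollary3p6 (R : realType) (n : nat) (L : set 'rV[R]_n)
    (B : 'M[R]_n) (n_gt0 : (0 < n)%N) (latL : is_lattice L)
    (basisB : is_basis L B) :
  orth_defect B <= 1 - (expR 1)^-1 * (n%:R / (seysen B + 1)) ^+ n.-1.
Proof.
have [fB _] := basisB.
have uB : B \in unitmx by rewrite -row_free_unit.
have iG : dual_basis B *m (dual_basis B)^T = invmx (B *m B^T).
  rewrite /dual_basis trmxK trmx_inv.
  have uG := posdefmx_unit (gram_posdefmx fB).
  rewrite -[LHS](mulmxK uG) !mulmxA mulmxKV // mulVmx ?unitmx_tr //.
  by rewrite mul1mx.
have [S_gt0 leD] := det_div_prod_diag_ge n_gt0 (gram_posdefmx fB).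
have SE : seysen B = \sum_i (B *m B^T) i i * invmx (B *m B^T) i i.
  by apply: eq_bigr => i _; rewrite !enorm_row_sqr iG.
rewrite -SE in S_gt0 leD.
rewrite /orth_defect; under eq_bigr do rewrite enorm_row_sqr.
rewrite lerD2l lerN2; apply: le_trans leD.
have S1_gt0 : 0 < seysen B + 1 by rewrite addr_gt0.
(* Two weakenings of [leD] give the claim: the factor [1/e] is at most 1, and [S + 1] replaces [S]
   in the denominator. *)
apply: (@le_trans _ _ ((n%:R / (seysen B + 1)) ^+ n.-1)).
  rewrite ler_piMl ?exprn_ge0 ?divr_ge0 ?(ltW S1_gt0) //.
  by rewrite invf_le1 ?expR_gt0 // -{1}expR0 ler_expR.
apply: lerXn2r; rewrite ?nnegrE ?divr_ge0 ?(ltW S_gt0) ?(ltW S1_gt0) //.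
by rewrite ler_pM2l ?ltr0n // lef_pV2 ?posrE // lerDl.
Qed.
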